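(* Let $H$ be a graph of order $n$ and size $m$ with $0<m<n-1$, and let $\mathbf x$ be a unit vector in $\mathbb R^n$ all of whose components are positive. Then $\mathbf x\,\mathcal S(H)\,\mathbf x^\top\le\rho(S_{n,m})$. Equality holds if and only if $m<(n-1)/2$, $H$ is isomorphic to $S_{n,m}$, and $\mathbf x$ is an eigenvector of $\mathcal S(H)$ for the eigenvalue $\rho(S_{n,m})$.
   Context: For a simple graph $H$ with vertices $v_1,\dots,v_n$, the Seidel matrix $\mathcal S(H)=(s_{ij})$ has $s_{ii}=0$, and for $i\ne j$, $s_{ij}=-1$ if $v_i,v_j$ are adjacent and $s_{ij}=1$ otherwise; $\rho(H)$ is the largest eigenvalue of $\mathcal S(H)$. Order means number of vertices, size means number of edges; vectors are row vectors whose components are indexed by the vertices $v_1,\dots,v_n$. For $0\le t\le n-1$, $S_{n,t}$ is the graph on $n$ vertices consisting of a star $K_{1,t}$ together with $n-t-1$ isolated vertices.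
   Formalization: The characterization of equality is stated only for n > 3, since for n = 3, m = 1, H = K_2 + K_1 and x = (1,1,2)/√6 equality holds although m = (n-1)/2; the inequality itself is stated for all n and m with 0 < m < n-1. *)

(* Defs.v *)
From mathcomp Require Import all_boot all_order all_algebra.
From mathcomp Require Import classical_sets reals complex polyrcf ring lra.

Set Implicit Arguments.
Unset Strict Implicit.
Unset Printing Implicit Defensive.

Import Order.TTheory GRing.Theory Num.Theory.
Local Open Scope ring_scope.

Record sgraph (n : nat) := SGraph {
  adj :> rel 'I_n;
  adj_sym : symmetric adj;
  adj_irr : irreflexive adj
}.

Definition edges n (H : sgraph n) : {set {set 'I_n}} :=
  [set e : {set 'I_n} | [exists i, exists j, H i j && (e == [set i; j])]].

Definition gsize n (H : sgraph n) : nat := #|edges H|.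

Definition isomorphic n (G H : sgraph n) : Prop :=
  exists2 f : 'I_n -> 'I_n, bijective f & forall i j, G i j = H (f i) (f j).

(* Vertex 0 is the centre, vertices 1, ..., t are the leaves, and the others
   are isolated; this is S_{n,t} when t <= n - 1. *)
Definition star_rel n (t : nat) : rel 'I_n := fun i j =>
  ((i == 0 :> nat) && (0 < j <= t)%N) || ((j == 0 :> nat) && (0 < i <= t)%N).

Fact star_rel_sym n t : symmetric (@star_rel n t).
Proof. by move=> i j; rewrite /star_rel orbC. Qed.

Fact star_rel_irr n t : irreflexive (@star_rel n t).
Proof. by move=> i; rewrite /star_rel; case: (nat_of_ord i). Qed.

Definition star n t : sgraph n := SGraph (@star_rel_sym n t) (@star_rel_irr n t).

Definition seidel (R : realType) n (H : sgraph n) : 'M[R]_n :=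
  \matrix_(i, j) (if i == j then 0 else if H i j then -1 else 1).

Definition eigenvector (R : realType) n (A : 'M[R]_n) (a : R) (x : 'rV[R]_n)
  : Prop := x != 0 /\ x *m A = a *: x.

Definition largest_eigenvalue (R : realType) n (A : 'M[R]_n) (r : R) : Prop :=
  eigenvalue A r /\ forall a, eigenvalue A a -> a <= r.

(* The default value 0 is only taken when n = 0; see [rhoP]. *)
Definition rho (R : realType) n (H : sgraph n) : R :=
  xget 0 (largest_eigenvalue (seidel R H)).

Definition unit_vector (R : realType) n (x : 'rV[R]_n) : Prop :=
  \sum_i x 0 i ^+ 2 = 1.

Lemma sym_eigenvalue_ex (R : rcfType) n (A : 'M[R]_n.+1) : A^T = A -> exists a, eigenvalue A a.
Proof.
move=> As.
pose f := real_complex R.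
have [z] : exists z, root (char_poly (map_mx f A)) z.
  by apply/closed_rootP; rewrite size_char_poly.
rewrite -eigenvalue_root_char => /[dup] ez /eigenvalueP [v Hv v0].
pose B := map_mx f A.
have HB : (map_mx Num.conj B)^T = B.
  apply/matrixP=> i j; rewrite !mxE.
  have -> : A j i = A i j by rewrite -{2}As mxE.
  by apply/CrealP; rewrite complex_real.
pose w := (map_mx Num.conj v)^T.
have Hw : B *m w = z^* *: w.
  rewrite -{1}HB /w -trmx_mul -map_mxM Hv map_mxZ.
  by apply/matrixP=> i j; rewrite !mxE.
have E : z *: (v *m w) = z^* *: (v *m w).
  by rewrite scalemxAl -Hv -mulmxA -/B Hw scalemxAr.
have : (v *m w) 0 0 != 0.
  rewrite !mxE psumr_eq0 => [|i _]; last by rewrite !mxE mul_conjC_ge0.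
  apply/negP=> /allP h; move/negP: v0; apply; apply/eqP/rowP=> i; rewrite mxE.
  by apply/eqP; rewrite -mul_conjC_eq0; have := h i (mem_index_enum _); rewrite !mxE.
move=> nz; have : z = z^* by apply: (mulIf nz); move/matrixP/(_ 0 0): E; rewrite !mxE.
move=> /esym/CrealP/complex_realP[k zk].
by exists k; rewrite -(eigenvalue_map f) /f /= -zk.
Qed.

Lemma sym_largest_eigenvalue_ex (R : realType) n (A : 'M[R]_n.+1) : A^T = A -> exists a, largest_eigenvalue A a.
Proof.
move=> /sym_eigenvalue_ex[a ea].
have p0 : char_poly A != 0 by rewrite monic_neq0 ?char_poly_monic.
have M b : eigenvalue A b = (b \in rootsR (char_poly A)).
  by rewrite eigenvalue_root_char -(roots_on_rootsR p0) inE andTb.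
exists (\big[Num.max/a]_(b <- rootsR (char_poly A)) b); split; last first.
  by move=> b; rewrite M => bi; apply: le_bigmax_seq.
rewrite M big_seq; apply: (big_ind (fun b => b \in _)) => //; first by rewrite -M.
by move=> b c; rewrite maxElt; case: ifP.
Qed.

Lemma rhoP (R : realType) n (H : sgraph n) : (0 < n)%N ->
  largest_eigenvalue (seidel R H) (rho R H).
Proof.
case: n H => // n H _; have [|r Hr] := @sym_largest_eigenvalue_ex R n (seidel R H).
  by apply/matrixP=> i j; rewrite !mxE eq_sym adj_sym.
exact: (xgetI 0 Hr).
Qed.

Lemma rhoE (R : realType) n (H : sgraph n) r :
  largest_eigenvalue (seidel R H) r -> rho R H = r.
Proof.
move=> Hr; have [e1 h1] := xgetI 0 Hr; case: Hr => e2 h2.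
by apply/eqP; rewrite eq_le h2 ?h1.
Qed.

Lemma rho_star31 (R : realType) : rho R (star 3 1) = 1.
Proof.
apply: rhoE; split.
  apply/eigenvalueP; exists (\row_i (if i == 2 :> nat then 2 else 1)).
    apply/rowP=> -[[|[|[|//]]] ?]; rewrite !mxE !big_ord_recl big_ord0 !mxE /=;
      rewrite /star_rel /=; ring.
  by apply/eqP=> /rowP/(_ ord0); rewrite !mxE /=; apply/eqP/oner_neq0.
move=> a /eigenvalueP[v Hv v0]; have := Hv.
pose i1 : 'I_3 := lift ord0 ord0; pose i2 : 'I_3 := lift ord0 (lift ord0 ord0).
have sum3 (F : 'I_3 -> R) : \sum_i F i = F ord0 + F i1 + F i2.
  rewrite !big_ord_recl big_ord0 addr0 addrA.
  by congr (F _ + F _ + F _); apply: val_inj.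
move/rowP=> h; have := h ord0; have := h i1; have := h i2.
rewrite !mxE !sum3 !mxE /= /star_rel /=.
set x := v 0 ord0; set y := v 0 i1; set z := v 0 i2.
move=> h2 h1 h0; rewrite leNgt; apply/negP=> a1.
have xy : (a - 1) * (x - y) = 0 by lra.
have xz : (a - 1) * (x + z) = 0 by lra.
move/eqP: xy; rewrite mulf_eq0 => /orP[/eqP|/eqP xy]; first by lra.
move/eqP: xz; rewrite mulf_eq0 => /orP[/eqP|/eqP xz]; first by lra.
have /eqP : (a + 2) * x = 0 by nra.
rewrite mulf_eq0 => /orP[/eqP|/eqP x0]; first by lra.
move/negP: v0; apply; apply/eqP/rowP=> i; rewrite mxE.
have -> : v 0 i = if i == 0 :> nat then x else if i == 1 :> nat then y else z.
  by case: i => -[|[|[|//]]] ? /=; congr (v 0 _); apply: val_inj.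
by case: ifP => _; [|case: ifP => _]; lra.
Qed.

Lemma gsize_star31 : gsize (star 3 1) = 1%N.
Proof.
rewrite /gsize; apply/eqP/cards1P; exists [set ord0; lift ord0 ord0].
apply/setP=> e; rewrite !inE; apply/existsP/eqP => [[i /existsP[j /andP[]]]|->].
  rewrite /= /star_rel => h /eqP ->.
  have [[-> ->]|[-> ->]] : (i = ord0 /\ j = lift ord0 ord0) \/ (j = ord0 /\ i = lift ord0 ord0).
    by case/orP: h => /andP[/eqP i0 /andP[j0 j1]]; [left|right]; split; apply: val_inj=> //=; apply/eqP; rewrite eqn_leq j0 j1.
    by [].
  by rewrite finset.setUC.
by exists ord0; apply/existsP; exists (lift ord0 ord0); rewrite eqxx andbT.
Qed.

(* For n = 3 and m = 1 the largest eigenvalue 1 of the Seidel matrix of S_{3,1}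
   is double, and it has the positive eigenvector (1, 1, 2), so that equality
   is attained although m = (n - 1) / 2. *)
Lemma equality_order3 (R : realType) : exists x : 'rV[R]_3,
  [/\ gsize (star 3 1) = 1%N, unit_vector x, forall i, 0 < x 0 i
    & (x *m seidel R (star 3 1) *m x^T) 0 0 = rho R (star 3 1)].
Proof.
have s6 : 0 < Num.sqrt (6 : R) by rewrite sqrtr_gt0.
have s62 : (Num.sqrt (6 : R))^-1 ^+ 2 = 6^-1 by rewrite exprVn sqr_sqrtr.
exists (\row_i ((if i == 2 :> nat then 2 else 1) / Num.sqrt 6)); split.
- exact: gsize_star31.
- rewrite /unit_vector !big_ord_recl big_ord0 !mxE /= !exprMn s62; lra.
- by move=> i; rewrite !mxE; apply: divr_gt0 => //; case: ifP.
rewrite rho_star31 !mxE !big_ord_recl !big_ord0 !mxE /=.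
rewrite !big_ord_recl !big_ord0 !mxE /= /star_rel /=.
set t := _^-1 in s62 *; lra.
Qed.

(* Main.v *)
Require Import Defs.
From mathcomp Require Import all_boot all_order all_algebra.
From mathcomp Require Import polyrcf ring lra zify.
From mathcomp Require Import classical_sets reals topology normedtype derive.
Set Implicit Arguments.
Unset Strict Implicit.
Unset Printing Implicit Defensive.
Import Order.TTheory GRing.Theory Num.Theory numFieldNormedType.Exports.
Local Open Scope ring_scope.

(** Put [mu = rho (star n m) + 1] and [s = n - 1 - m].  Then [mu >= n - 1] and
[mu ^ 2 * (n - mu) = 4 * m * s].  After rescaling [x] to a vector [z] of sum
[mu], the inequality reads [energy H mu z >= mu * (n - mu)], where
[energy H mu z = mu * sum_i (1 - z_i) ^ 2 + 4 * sum_(ij edge) z_i * z_j], and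
this is proved for every [z >= 0].

Since the cubic equation is symmetric in [m] and [s], and deleting edges
decreases the energy, one may assume [m <= s].  Consider a minimizer [z] of the
energy in a large box.  If some [z_i] vanishes, the energy is at least [mu].
Otherwise [z] is a stationary point, [1 - z_i = th * sum_(j ~ i) z_j] with
[th = 2 / mu], so that the energy is [2 * sum_(ij edge) (z_i + z_j)].  As two
distinct edges share at most one vertex, adjacent vertices have degrees summing
to at most [m + 1]; together with [z_k <= 1 - th * z_i] for [k] adjacent to [i]
this gives two linear inequalities in [z_i] and [z_j], which imply
[z_i + z_j >= th * s] for every edge [ij].  Summing over the [m] edges gives the
bound.  Equality forces the endpoint with the smaller value to have degree [m],
so that [H] is a star. *)

(** * Neighbourhoods and edges *)

Section Edges.
Variable n : nat.
Implicit Type H : sgraph n.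

Definition nbr H (i : 'I_n) : {set 'I_n} := [set j | H i j].

Lemma in_nbr H i j : (j \in nbr H i) = H i j.
Proof. by rewrite inE. Qed.

Lemma set2_eq (i j k l : 'I_n) : [set i; j] = [set k; l] ->
  (i = k /\ j = l) \/ (i = l /\ j = k).
Proof.
move=> e.
have /set2P hi : i \in [set k; l] by rewrite -e set21.
have /set2P hj : j \in [set k; l] by rewrite -e set22.
have /set2P hk : k \in [set i; j] by rewrite e set21.
have /set2P hl : l \in [set i; j] by rewrite e set22.
by intuition congruence.
Qed.

Lemma adj_neq H i j : H i j -> i != j.
Proof. by apply: contraTneq => ->; rewrite adj_irr. Qed.

Lemma mem_edges H i j : ([set i; j] \in edges H) = H i j.
Proof.
rewrite inE; apply/existsP/idP => [[k /existsP[l /andP[Hkl /eqP e]]]|Hij].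
  by have [[-> ->]|[-> ->]] := set2_eq e; rewrite // adj_sym.
by exists i; apply/existsP; exists j; rewrite Hij eqxx.
Qed.

Lemma edgesP H e : reflect (exists i j, H i j /\ e = [set i; j]) (e \in edges H).
Proof.
rewrite inE; apply: (iffP existsP) => [[i /existsP[j /andP[Hij /eqP ->]]]|].
  by exists i, j.
by case=> i [j [Hij ->]]; exists i; apply/existsP; exists j; rewrite Hij eqxx.
Qed.

(** Each edge comes from exactly two ordered pairs, [(i, j)] and [(j, i)]. *)
Lemma card_adj H : \sum_(p : 'I_n * 'I_n | H p.1 p.2) 1 = (2 * gsize H)%N :> nat.
Proof.
rewrite (partition_big (fun p => [set p.1; p.2]) [in edges H]) /=; last first.
  by move=> p; rewrite mem_edges.
rewrite mulnC -sum_nat_const; apply: eq_bigr => e /edgesP[i [j [Hij ->]]].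
rewrite (bigD1 (i, j)) /= ?Hij ?eqxx // (bigD1 (j, i)) /=; last first.
  rewrite adj_sym Hij /= finset.setUC eqxx /=.
  by apply: contra_neq (adj_neq Hij) => -[].
rewrite big1 // => -[k l] /= /andP[/andP[/andP[_ /eqP/set2_eq]]].
by case=> -[-> ->]; rewrite eqxx.
Qed.

Lemma set2_inj (i : 'I_n) : injective (fun k => [set i; k]).
Proof. by move=> j k /set2_eq[[]|[-> ->]]. Qed.

(** The edges through [i] correspond injectively to its neighbours, so a full degree leaves no other
    edge. *)
Lemma deg_max H i : #|nbr H i| = gsize H ->
  forall j k, H j k -> (j == i) || (k == i).
Proof.
move=> d j k Hjk.
have /eqP E : (fun k => [set i; k]) @: nbr H i == edges H.
  rewrite eqEcard card_imset ?d ?leqnn ?andbT; last exact: set2_inj.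
  by apply/fintype.subsetP=> e /imsetP[l]; rewrite in_nbr => Hil ->; rewrite mem_edges.
move: Hjk; rewrite -mem_edges -E => /imsetP[l _ /set2_eq[][-> ->]];
  by rewrite eqxx ?orbT.
Qed.

(** The edges at [i] and those at [j] meet only in the edge [ij]; inclusion-exclusion gives the
    bound. *)
Lemma deg_adj H i j : H i j -> (#|nbr H i| + #|nbr H j| <= (gsize H).+1)%N.
Proof.
move=> Hij; set Ei := (fun k => [set i; k]) @: nbr H i.
set Ej := (fun k => [set j; k]) @: nbr H j.
rewrite -(card_imset _ (@set2_inj i)) -(card_imset _ (@set2_inj j)).
rewrite -/Ei -/Ej -cardsUI -addn1; apply: leq_add.
  apply: subset_leq_card; apply/fintype.subsetP=> e /setUP[] /imsetP[l];
    by rewrite in_nbr => Hl ->; rewrite mem_edges.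
rewrite -(cards1 ([set i; j])); apply: subset_leq_card.
apply/fintype.subsetP=> e /setIP[/imsetP[k _ ->] /imsetP[l _ /set2_eq]].
by case=> -[e1 ->]; rewrite ?inE //; have := adj_neq Hij; rewrite e1 eqxx.
Qed.

(** Serves the case [m > s], which is reduced to a subgraph with [s] edges. *)
Lemma subgraph H (s : nat) : (s <= gsize H)%N ->
  exists2 K : sgraph n, gsize K = s & forall i j, K i j -> H i j.
Proof.
move=> /card_geqP[l [ul sl lE]].
have le (e : {set 'I_n}) : e \in l -> e \in edges H by exact: lE.
pose r (i j : 'I_n) := [set i; j] \in l.
have rs : symmetric r by move=> i j; rewrite /r finset.setUC.
have ri : irreflexive r.
  by move=> i; apply/negP => /le; rewrite mem_edges adj_irr.
exists (SGraph rs ri) => [|i j]; last by move/le; rewrite mem_edges.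
rewrite -sl -(card_uniqP ul); apply: eq_card => e; apply/edgesP/idP.
  by case=> i [j [rij ->]].
by move=> el; have /edgesP[i [j [_ ee]]] := le _ el; exists i, j; rewrite /= /r -ee.
Qed.

(** The vertices are listed as [i], then its neighbours, then the others; the position in this list
    is the isomorphism. *)
Lemma star_iso H i : #|nbr H i| = gsize H -> isomorphic H (star n (gsize H)).
Proof.
move=> d; set m := gsize H.
pose t := i :: enum (nbr H i); pose l := t ++ enum [predC t].
have ut : uniq t by rewrite /= enum_uniq mem_enum in_nbr adj_irr.
have ul : uniq l.
  rewrite cat_uniq ut enum_uniq andbT /=; apply/hasPn => j; rewrite mem_enum.
  by [].
have ml j : j \in l.
  by rewrite mem_cat [X in _ || X]mem_enum -[X in _ || X]/(j \notin t) orbN.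
have sl : size l = n.
  by rewrite -(card_uniqP ul) -[RHS](card_ord n); apply: eq_card => j; rewrite ml.
have fP j : (index j l < n)%N by rewrite -[X in (_ < X)%N]sl index_mem.
pose f j := Ordinal (fP j).
have f0 j : (f j == 0 :> nat) = (j == i).
  by rewrite [j == i]eq_sym /=; case: (eqVneq i j).
have f1 j : (0 < f j <= m)%N = H i j.
  (* The prefix [t] has [m + 1] elements, so the positions up to [m] are exactly those of its
     elements. *)
  rewrite lt0n f0; have -> : (f j <= m)%N = (j \in t).
    have -> : m = (size t).-1 by rewrite /= -cardE.
    rewrite -[(f j <= _)%N]/(index j l < size t)%N index_cat -index_mem.
    by case: ifP => // _; rewrite ltnNge leq_addr.
  rewrite inE mem_enum in_nbr; case: eqVneq => [->|] //=.
  by rewrite adj_irr.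
exists f => [|j k].
  apply: injF_bij => j k e.
  by rewrite -(nth_index i (ml j)) (_ : index j l = index k l) ?nth_index //; case: e.
rewrite /= /star_rel !f0 !f1; apply/idP/idP => [Hjk|].
  have /orP[/eqP e|/eqP e] := deg_max d Hjk; first by rewrite -e eqxx Hjk.
  by rewrite -e eqxx adj_sym Hjk orbT.
by case/orP => /andP[/eqP ->]; rewrite // adj_sym.
Qed.

End Edges.

(** * The energy and its minimizers *)

Section Energy.
Variables (R : realType) (n : nat).
Implicit Types (H : sgraph n) (z : 'rV[R]_n) (mu th : R).

Definition nsum H z i : R := \sum_j (H i j)%:R * z 0 j.

(** The last sum runs over ordered pairs, so an edge [ij] contributes [4 * z_i * z_j]. *)
Definition energy H mu z : R :=
  mu * \sum_i (1 - z 0 i) ^+ 2 + 2 * \sum_i z 0 i * nsum H z i.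

Lemma nsum_nbr H z i : nsum H z i = \sum_(j in nbr H i) z 0 j.
Proof.
rewrite /nsum [RHS]big_mkcond /=; apply: eq_bigr => j _; rewrite in_nbr.
by case: (H i j); rewrite ?mul1r ?mul0r.
Qed.

Lemma energy_continuous H mu : continuous (energy H mu).
Proof.
have cs (I : finType) (F : I -> 'rV[R]_n -> R) :
    (forall i, continuous (F i)) -> continuous (fun z => \sum_i F i z).
  by move=> cF; apply: continuous_big => [|i _]; [exact: add_continuous|exact: cF].
have cz i : continuous (fun z : 'rV[R]_n => z 0 i).
  by apply: (@coord_continuous R 1 n 0 i).
have cc (c : R) : continuous (fun z : 'rV[R]_n => c) by apply: cst_continuous.
have cM (f g : 'rV[R]_n -> R) : continuous f -> continuous g ->
    continuous (fun z => f z * g z).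
  by move=> cf cg z; apply: (continuousM (cf z) (cg z)).
have cD (f g : 'rV[R]_n -> R) : continuous f -> continuous g ->
    continuous (fun z => f z + g z).
  by move=> cf cg z; apply: (continuousD (cf z) (cg z)).
have cB i : continuous (fun z : 'rV[R]_n => 1 - z 0 i).
  by move=> z; apply: (continuousB (cc 1 z) (cz i z)).
apply: (cD); apply: (cM) => //; apply: (cs) => i; first exact: (cM).
by apply: (cM) => //; apply: (cs) => j; apply: (cM).
Qed.

Lemma nsum_ge0 H z i : (forall j, 0 <= z 0 j) -> 0 <= nsum H z i.
Proof. by move=> z0; apply: sumr_ge0 => j _; rewrite mulr_ge0. Qed.

(** In one coordinate the energy is a quadratic polynomial. The edge sum is affine in [t] because no
    vertex is adjacent to itself. *)
Lemma energy_move H mu z i t :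
  energy H mu (z + t *: delta_mx 0 i) =
  energy H mu z + t * (4 * nsum H z i - 2 * mu * (1 - z 0 i)) + mu * t ^+ 2.
Proof.
have dE k : (delta_mx 0 i : 'rV[R]_n) 0 k = (k == i)%:R by rewrite mxE eqxx.
have zE k : (z + t *: delta_mx 0 i) 0 k = z 0 k + t * (k == i)%:R.
  by rewrite !mxE eqxx.
have sE (F : 'I_n -> R) : \sum_k (k == i)%:R * F k = F i.
  rewrite (bigD1 i) //= eqxx mul1r big1 ?addr0 // => k /negbTE ->.
  by rewrite mul0r.
have nE k : nsum H (z + t *: delta_mx 0 i) k = nsum H z k + t * (H k i)%:R.
  rewrite /nsum -[X in t * X](sE (fun j => (H k j)%:R)) mulr_sumr -big_split /=.
  by apply: eq_bigr => j _; rewrite zE; ring.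
rewrite /energy.
have -> : \sum_k (1 - (z + t *: delta_mx 0 i) 0 k) ^+ 2 =
    \sum_k (1 - z 0 k) ^+ 2 - 2 * t * (1 - z 0 i) + t ^+ 2.
  transitivity (\sum_k ((1 - z 0 k) ^+ 2 - 2 * t * ((k == i)%:R * (1 - z 0 k))
      + (k == i)%:R * t ^+ 2)); last first.
    by rewrite big_split /= sumrB -mulr_sumr !sE.
  by apply: eq_bigr => k _; rewrite zE; case: eqP => _; rewrite /=; ring.
have -> : \sum_k (z + t *: delta_mx 0 i) 0 k * nsum H (z + t *: delta_mx 0 i) k =
    \sum_k z 0 k * nsum H z k + 2 * t * nsum H z i.
  under eq_bigr => k _ do rewrite zE nE mulrDl 2!mulrDr addrA.
  rewrite !big_split /= -!addrA; congr (_ + _).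
  have -> : \sum_k z 0 k * (t * (H k i)%:R) = t * nsum H z i.
    by rewrite mulr_sumr; apply: eq_bigr => k _; rewrite adj_sym; ring.
  have -> : \sum_k t * (k == i)%:R * nsum H z k = t * nsum H z i.
    by rewrite -(sE (nsum H z)) mulr_sumr; apply: eq_bigr => k _; ring.
  rewrite big1 => [|k _]; first by ring.
  by case: eqP => [->|_]; rewrite ?adj_irr /= ?(mulr0, mul0r).
by ring.
Qed.

(** If the partial derivative [g] were nonzero, a small move of coordinate [i] against its sign
    would lower the energy. *)
Lemma energy_min_stationary H mu K z i : 0 < mu -> 1 <= K ->
    (forall j, 0 <= z 0 j) -> 0 < z 0 i <= K ->
    (forall t, 0 <= z 0 i + t <= K ->
      energy H mu z <= energy H mu (z + t *: delta_mx 0 i)) ->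
  mu * (1 - z 0 i) = 2 * nsum H z i.
Proof.
move=> mu0 K1 z0 /andP[zi0 ziK] zmin; set g := 4 * nsum H z i - 2 * mu * (1 - z 0 i).
have D0 := nsum_ge0 H i z0.
have gt t : 0 <= z 0 i + t <= K -> 0 <= t * (g + mu * t).
  by move=> /zmin; rewrite energy_move -/g; lra.
suff : g = 0 by rewrite /g; lra.
apply/eqP; rewrite eq_le; apply/andP; split; rewrite leNgt; apply/negP => g0.
  (* This choice keeps [mu * e <= g / 2], so the linear gain outweighs the quadratic cost. *)
  pose e := Num.min (z 0 i) (g / (2 * mu)).
  have e0 : 0 < e by rewrite lt_min zi0 divr_gt0 // mulr_gt0.
  have ez : e <= z 0 i by rewrite ge_min lexx.
  have eg : e <= g / (2 * mu) by rewrite ge_min lexx orbT.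
  have eg' : mu * e <= g / 2.
    by move: eg; rewrite invfM mulrA ler_pdivlMr // mulrC.
  have /gt : 0 <= z 0 i + - e <= K by apply/andP; split; lra.
  by rewrite mulNr oppr_ge0 pmulr_rle0 //; lra.
(* At the upper end [z 0 i = K] no upward move is available, but there [K >= 1] already gives
   [g >= 0]. *)
have [zK|zK] : z 0 i = K \/ z 0 i < K by move: ziK; rewrite le_eqVlt => /orP[/eqP|]; auto.
  by move: g0; rewrite /g zK; nra.
pose e := Num.min (K - z 0 i) (- g / (2 * mu)).
have e0 : 0 < e by rewrite lt_min subr_gt0 zK divr_gt0 // ?mulr_gt0 // oppr_gt0.
have ez : e <= K - z 0 i by rewrite ge_min lexx.
have eg : e <= - g / (2 * mu) by rewrite ge_min lexx orbT.
have eg' : mu * e <= - g / 2.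
  by move: eg; rewrite invfM mulrA ler_pdivlMr // mulrC.
have /gt : 0 <= z 0 i + e <= K by apply/andP; split; lra.
by rewrite pmulr_rge0 //; lra.
Qed.

(** A minimizer over the compact box [[0, K]^n] is taken, with [K] at least 1 and at least every
    entry of [z]. *)
Lemma energy_argmin H mu z : 0 < mu -> (forall i, 0 <= z 0 i) ->
  exists w : 'rV[R]_n, [/\ energy H mu w <= energy H mu z,
    (forall i, 0 <= w 0 i) &
    (exists i, w 0 i = 0) \/
    (forall i, 0 < w 0 i /\ mu * (1 - w 0 i) = 2 * nsum H w i)].
Proof.
move=> mu0 z0; pose K := 1 + \sum_i z 0 i.
have zK i : z 0 i <= K.
  rewrite /K (bigD1 i) //= addrCA lerDl addr_ge0 //; exact: sumr_ge0.
have K1 : 1 <= K by rewrite lerDl sumr_ge0.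
pose B : set 'rV[R]_n :=
  [set v : 'rV[R]_n | forall i, (`[0, K] : set R)%classic (v ord0 i)]%classic.
have memB (v : 'rV[R]_n) : v \in B <-> forall i, 0 <= v 0 i <= K.
  split=> [/set_mem h i|h]; first by have := h i; rewrite /= in_itv.
  by apply: mem_set => i /=; rewrite in_itv; exact: h.
have zB : z \in B by apply/memB => i; rewrite z0 zK.
have cB : compact B.
  apply: (@rV_compact R n (fun=> `[0, K]%classic)) => i; exact: segment_compact.
have B0 : (B !=set0)%classic by exists z; exact: set_mem.
have cV : {within B, continuous (energy H mu)}%classic.
  by apply: continuous_subspaceT; exact: energy_continuous.
have [w /memB wB wmin] := EVT_min_rV B0 cB cV.
have w0 j : 0 <= w 0 j by have /andP[] := wB j.
exists w; split=> //; first exact: wmin.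
have [/existsP[i /eqP wi]|/existsPn wn] := boolP [exists i, w 0 i == 0].
  by left; exists i.
right=> i; have wi : 0 < w 0 i by rewrite lt_neqAle eq_sym wn w0.
split=> //; apply: (@energy_min_stationary _ _ K) => // [|t ht].
  by rewrite wi; have /andP[] := wB i.
apply: wmin; apply/memB => j; rewrite !mxE eqxx /=.
by case: eqP => [->|_]; rewrite ?mulr1 // mulr0 addr0.
Qed.

End Energy.

(** * Lower bound for the energy *)

(** Here [a <= b] are the values at the ends of an edge and [p], [q] their degrees. A nonnegative
    combination of two linear inequalities gives [(1 - th ^ 2 * m) * (a + b) >= 2 - th * (m + 1)],
    whose right side is [th * s * (1 - th ^ 2 * m)] by the cubic equation. *)
Lemma edge_weight_bound (R : realFieldType) (th m s a b p q : R) :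
    0 < th -> 1 <= m -> m <= s -> th * (m + s) <= 2 ->
    2 - th * (m + 1) = th * s * (1 - th ^+ 2 * m) ->
    0 < a <= 1 -> a <= b -> 1 <= p -> 1 <= q -> p + q <= m + 1 ->
    1 - a <= th * (b + (p - 1) * (1 - th * a)) ->
    1 - b <= th * (a + (q - 1) * (1 - th * b)) ->
  th * s <= a + b /\ (3 <= m + s -> a + b = th * s -> p = m /\ m < s).
Proof.
move=> th0 m1 ms thms cub /andP[a0 a1] ab p1 q1 pq ea eb.
have thm : th * m <= 1.
  by have := ler_wpM2l (ltW th0) ms; move: thms; rewrite mulrDr; lra.
have th1 : th <= 1 by have := ler_wpM2l (ltW th0) m1; rewrite mulr1; lra.
have tha : 0 <= 1 - th * a by have := ler_pM (ltW th0) (ltW a0) th1 a1; lra.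
(* [A] and [C] are the multipliers of [e1] and [e2] below that eliminate [a]. *)
pose A := th ^+ 2 * (m - 1); pose C := 1 - th - A.
have A0 : 0 <= A by rewrite mulr_ge0 ?sqr_ge0 //; lra.
have C0 : 0 <= C.
  have : th * (th * (m - 1)) <= th * (1 - th) by rewrite ler_pM2l //; lra.
  have : th * (1 - th) <= 1 * (1 - th) by rewrite ler_wpM2r //; lra.
  by rewrite /C /A; lra.
have step1 : (p - 1) * (1 - th * a) <= (m - 1) * (1 - th * a).
  by rewrite ler_wpM2r //; lra.
(* As [a <= b], both factors are at most [1 - th * a], and [p - 1] and [q - 1] add up to at most
   [m - 1]. *)
have step2 : (p - 1) * (1 - th * a) + (q - 1) * (1 - th * b)
    <= (m - 1) * (1 - th * a).
  have : (q - 1) * (1 - th * b) <= (q - 1) * (1 - th * a).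
    by rewrite ler_wpM2l ?lerB ?ler_pM2l //; lra.
  have : (p - 1 + (q - 1)) * (1 - th * a) <= (m - 1) * (1 - th * a).
    by rewrite ler_wpM2r //; lra.
  by rewrite mulrDl; lra.
have e1 : 1 - a <= th * (b + (m - 1) * (1 - th * a)).
  by apply: le_trans ea _; rewrite ler_pM2l // lerD2l.
have e2 : 2 - (a + b) <= th * (a + b + (m - 1) * (1 - th * a)).
  have := ler_wpM2l (ltW th0) step2; lra.
have e1A := ler_wpM2l A0 e1.
have e2C := ler_wpM2l C0 e2.
have det : th ^+ 2 * m <= th by rewrite expr2 -mulrA ger_pMr.
split.
  (* If this factor is not positive, then [th = 1] and [m = s = 1], and [e2] alone suffices. *)
  have [d|d] : 0 < 1 - th ^+ 2 * m \/ 1 - th ^+ 2 * m <= 0 by lra.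
    rewrite -(ler_pM2l d) [X in X <= _]mulrC -cub.
    by move: e1A e2C; rewrite /C /A; lra.
  have t1 : th = 1 by lra.
  by move: e2; rewrite t1 in thms thm *; nra.
move=> ms3 e.
(* The condition [3 <= m + s] rules out the degenerate case [th = 1]. *)
have th1' : th < 1.
  rewrite ltNge; apply/negP => h; have := ler_pM _ _ h ms3; lra.
have tha' : 0 < 1 - th * a.
  by have := ler_pM (ltW th0) (ltW a0) (lexx th) a1; lra.
(* For [m = s] the cubic equation factors and leaves only [th * m = 1], which contradicts [e2]. *)
have msl : m < s.
  rewrite lt_neqAle ms andbT; apply/eqP => ems; rewrite -ems in cub e.
  have : (1 - th * m) * (2 - th * (1 + th * m)) = 0 by lra.
  move/eqP; rewrite mulf_eq0 => /orP[] /eqP h; last first.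
    by have : th * (1 + th * m) <= th * 2; [rewrite ler_pM2l //; lra|lra].
  have h' : th * m = 1 by lra.
  have : 0 < (1 - th) * (th * a) by rewrite !mulr_gt0 //; lra.
  have : th * ((m - 1) * (1 - th * a)) = (th * m - th) * (1 - th * a) by ring.
  by move: e2; rewrite e h'; lra.
split=> //; have [m1'|m1'] : m = 1 \/ 1 < m by lra.
  lra.
apply/eqP; rewrite eq_le; apply/andP; split; first lra.
rewrite leNgt; apply/negP => pm.
(* If [p < m], the first inequality is strict and its multiplier [A] is positive, so the combination
   is strict as well. *)
have A0' : 0 < A by rewrite mulr_gt0 ?exprn_gt0 //; lra.
have e1' : 1 - a < th * (b + (m - 1) * (1 - th * a)).
  by apply: le_lt_trans ea _; rewrite ltr_pM2l // ltrD2l ltr_pM2r //; lra.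
rewrite -(ltr_pM2l A0') in e1'.
have bE : b = th * s - a by lra.
move: e1' e2C; rewrite bE /C /A => h1 h2.
suff : (1 - th ^+ 2 * m) * (th * s) > th * s * (1 - th ^+ 2 * m) by rewrite mulrC ltxx.
rewrite -cub; lra.
Qed.

(** * Stationary points with positive entries *)

Section Stationary.
Variables (R : realType) (n : nat) (H : sgraph n) (mu s : R) (z : 'rV[R]_n).
Let m : R := (gsize H)%:R.
Hypotheses (m1 : 1 <= m) (ms : m <= s) (mu_ge : m + s <= mu).
Hypothesis cubic : mu ^+ 2 * (1 + m + s - mu) = 4 * m * s.
Hypothesis z0 : forall i, 0 < z 0 i.
Hypothesis stat : forall i, mu * (1 - z 0 i) = 2 * nsum H z i.

Let mu0 : 0 < mu.
Proof.
apply: lt_le_trans mu_ge; apply: ltr_pwDl; first exact: lt_le_trans m1.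
exact: le_trans (le_trans m1 ms).
Qed.
Let th := 2 / mu.
Let thmu : th * mu = 2. Proof. by rewrite /th divfK // gt_eqF. Qed.
Let th0 : 0 < th. Proof. by rewrite divr_gt0. Qed.

Let statE i : 1 - z 0 i = th * nsum H z i.
Proof.
by apply: (mulfI (lt0r_neq0 mu0)); rewrite stat mulrA [mu * th]mulrC thmu.
Qed.

Let z_le1 i : z 0 i <= 1.
Proof.
rewrite -subr_ge0 statE mulr_ge0 ?(ltW th0) //.
by apply: nsum_ge0 => j; apply/ltW.
Qed.

Let z_nbr i k : H i k -> z 0 k <= 1 - th * z 0 i.
Proof.
move=> Hik; suff : th * z 0 i <= 1 - z 0 k by lra.
rewrite statE ler_pM2l // nsum_nbr (bigD1 i) /= ?in_nbr ?(adj_sym H k) //.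
by rewrite lerDl sumr_ge0 // => j _; apply/ltW.
Qed.

(** The neighbour [j] is kept, and every other neighbour of [i] is bounded by [1 - th * z 0 i]. *)
Let statD i j : H i j ->
  1 - z 0 i <= th * (z 0 j + (#|nbr H i|%:R - 1) * (1 - th * z 0 i)).
Proof.
move=> Hij; rewrite statE ler_pM2l // nsum_nbr (bigD1 j) ?in_nbr //= lerD2l.
have -> : #|nbr H i|%:R - 1 = #|nbr H i :\ j|%:R :> R.
  by rewrite (cardsD1 j (nbr H i)) in_nbr Hij natrD /= addrAC subrr add0r.
rewrite mulr_natl -sumr_const.
under eq_bigl => k do rewrite andbC -in_setD1.
by apply: ler_sum => k; rewrite in_setD1 in_nbr => /andP[_ /z_nbr].
Qed.

Lemma stationary_edge i j : H i j -> z 0 i <= z 0 j ->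
  th * s <= z 0 i + z 0 j /\
  (3 <= m + s -> z 0 i + z 0 j = th * s -> #|nbr H i|%:R = m /\ m < s).
Proof.
move=> Hij zij.
have Hji : H j i by rewrite adj_sym.
have deg1 k l : H k l -> 1 <= #|nbr H k|%:R :> R.
  by move=> Hkl; rewrite ler1n card_gt0; apply/set0Pn; exists l; rewrite in_nbr.
apply: (@edge_weight_bound _ th m s _ _ _ #|nbr H j|%:R) => //.
- by rewrite -thmu ler_pM2l.
(* Multiplication by [th ^ 3] eliminates [mu] from the cubic equation. *)
- have : th ^+ 3 * (mu ^+ 2 * (1 + m + s - mu)) = th ^+ 3 * (4 * m * s) by rewrite cubic.
  have -> : th ^+ 3 * (mu ^+ 2 * (1 + m + s - mu)) =
     (th * mu) ^+ 2 * (th * (1 + m + s) - th * mu) by ring.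
  rewrite thmu; lra.
- by rewrite z0 z_le1.
- exact: deg1 Hij.
- exact: deg1 Hji.
- by rewrite -natrD natr1 ler_nat; exact: deg_adj.
- exact: statD.
- exact: statD.
Qed.

Lemma stationary_pair i j : H i j -> th * s <= z 0 i + z 0 j.
Proof.
move=> Hij; have [zij|/ltW zji] := leP (z 0 i) (z 0 j).
  by case: (stationary_edge Hij zij).
by rewrite addrC; rewrite adj_sym in Hij; case: (stationary_edge Hij zji).
Qed.

(** Stationarity turns [mu * (1 - z_i) ^ 2] into [2 * (1 - z_i) * nsum H z i], and the products
    [z_i * nsum H z i] cancel. *)
Lemma stationary_energy :
  energy H mu z = \sum_(p : 'I_n * 'I_n | H p.1 p.2) (z 0 p.1 + z 0 p.2).
Proof.
transitivity (2 * \sum_i nsum H z i).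
  rewrite /energy !mulr_sumr -big_split /=; apply: eq_bigr => i _.
  have -> : mu * (1 - z 0 i) ^+ 2 = mu * (1 - z 0 i) * (1 - z 0 i) by ring.
  by rewrite stat; ring.
rewrite big_split /= mulr_natl mulr2n; congr (_ + _).
  rewrite -(pair_big_dep xpredT (fun i j => H i j) (fun i j => z 0 i)) /=.
  rewrite [RHS](exchange_big_dep xpredT) //=; apply: eq_bigr => j _.
  rewrite nsum_nbr; apply: eq_bigl => i; by rewrite in_nbr adj_sym.
rewrite -(pair_big_dep xpredT (fun i j => H i j) (fun i j => z 0 j)) /=.
by apply: eq_bigr => i _; rewrite nsum_nbr; apply: eq_bigl => j; rewrite in_nbr.
Qed.

(** Spreads the bound over the [2 * m] ordered adjacent pairs, to be compared term by term. *)
Lemma energy_bound_sum :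
  mu * (1 + m + s - mu) = \sum_(p : 'I_n * 'I_n | H p.1 p.2) (th * s).
Proof.
have -> : \sum_(p : 'I_n * 'I_n | H p.1 p.2) (th * s) = (2 * m) * (th * s).
  by rewrite big_const iter_addr_0 -sum1_card card_adj -[LHS]mulr_natl natrM.
apply: (mulfI (lt0r_neq0 mu0)); rewrite mulrA -expr2 cubic.
have -> : mu * (2 * m * (th * s)) = th * mu * (2 * m * s) by ring.
rewrite thmu; ring.
Qed.

Lemma stationary_bound : mu * (1 + m + s - mu) <= energy H mu z.
Proof.
rewrite stationary_energy energy_bound_sum; apply: ler_sum => p; exact: stationary_pair.
Qed.

(** Equality of the sums makes every edge tight; the endpoint of smaller value of any one edge then
    has full degree. *)
Lemma stationary_eq : 3 <= m + s -> energy H mu z = mu * (1 + m + s - mu) ->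
  (exists i, #|nbr H i| = gsize H) /\ m < s.
Proof.
move=> ms3 E.
have eq_edge i j : H i j -> z 0 i + z 0 j = th * s.
  move=> Hij; apply/eqP; rewrite -subr_eq0.
  have : \sum_(p : 'I_n * 'I_n | H p.1 p.2) (z 0 p.1 + z 0 p.2 - th * s) == 0.
    by rewrite sumrB -stationary_energy -energy_bound_sum E subrr.
  rewrite psumr_eq0 => [/allP/(_ (i, j) (mem_index_enum _)) /=|p Hp].
    by rewrite Hij.
  by rewrite subr_ge0; exact: stationary_pair.
have conc i j : H i j -> z 0 i <= z 0 j -> (exists i, #|nbr H i| = gsize H) /\ m < s.
  move=> Hij zij; have [_ /(_ ms3 (eq_edge _ _ Hij))[d sm]] := stationary_edge Hij zij.
  by split=> //; exists i; apply/eqP; rewrite -(eqr_nat R) d.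
have /card_gt0P[e /edgesP[i [j [Hij _]]]] : (0 < gsize H)%N.
  by rewrite -(ltr_nat R); move: m1; rewrite /m; lra.
have [zij|/ltW zji] := leP (z 0 i) (z 0 j); first exact: conc zij.
by apply: conc zji; rewrite adj_sym.
Qed.
End Stationary.

(** * The energy bound for arbitrary nonnegative vectors *)

Section EnergyBound.
Variables (R : realType) (n : nat) (H : sgraph n) (mu s : R).
Let m : R := (gsize H)%:R.
Hypotheses (m1 : 1 <= m) (ms : m <= s) (mu_ge : m + s <= mu).
Hypothesis cubic : mu ^+ 2 * (1 + m + s - mu) = 4 * m * s.

Let mu0 : 0 < mu.
Proof.
apply: lt_le_trans mu_ge; apply: ltr_pwDl; first exact: lt_le_trans m1.
exact: le_trans (le_trans m1 ms).
Qed.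

Lemma energy_bound (z : 'rV[R]_n) : (forall i, 0 <= z 0 i) ->
  mu * (1 + m + s - mu) <= energy H mu z.
Proof.
move=> z0; have [v [vz v0 [[i vi]|vs]]] := energy_argmin H mu0 z0; last first.
  apply: le_trans vz; apply: stationary_bound => // i; by case: (vs i).
(* The zero coordinate alone contributes [mu], and [1 + m + s - mu <= 1]. *)
apply: le_trans vz; apply: (@le_trans _ _ mu).
  by rewrite ger_pMr // -!addrA gerDl addrA subr_le0.
rewrite /energy (bigD1 i) //= vi subr0 expr1n mulrDr mulr1 -addrA lerDl addr_ge0 //.
  by rewrite mulr_ge0 ?(ltW mu0) // sumr_ge0 // => j _; exact: sqr_ge0.
by rewrite mulr_ge0 // sumr_ge0 // => j _; rewrite mulr_ge0 ?nsum_ge0.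
Qed.

(** A positive vector attaining the bound minimizes the energy among nonnegative vectors, hence is
    itself stationary. *)
Lemma energy_eq (z : 'rV[R]_n) : 3 <= m + s -> (forall i, 0 < z 0 i) ->
    energy H mu z = mu * (1 + m + s - mu) ->
  [/\ exists i, #|nbr H i| = gsize H, m < s
    & forall i, mu * (1 - z 0 i) = 2 * nsum H z i].
Proof.
move=> ms3 z0 E; have z0' i : 0 <= z 0 i by exact/ltW.
have st i : mu * (1 - z 0 i) = 2 * nsum H z i.
  apply: (@energy_min_stationary _ _ _ _ (1 + z 0 i)) => // [||t /andP[zt _]].
  - by rewrite lerDl.
  - by rewrite z0 lerDr ler01.
  rewrite E; apply: energy_bound => j; rewrite !mxE eqxx /=.
  by case: eqP => [->|_]; rewrite ?mulr1 // mulr0 addr0.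
by have [] := stationary_eq m1 ms mu_ge cubic z0 st ms3 E.
Qed.
End EnergyBound.

(** * The largest eigenvalue of a star *)

(** The Seidel matrix is [J - I - 2 A], with [J] the all-ones matrix and [A] the adjacency
    matrix. *)
Lemma seidel_mulE (R : realType) n (H : sgraph n) (x : 'rV[R]_n) i :
  (x *m seidel R H) 0 i = \sum_j x 0 j - x 0 i - 2 * nsum H x i.
Proof.
have -> : x 0 i = \sum_j (j == i)%:R * x 0 j.
  by rewrite (bigD1 i) //= eqxx mul1r big1 ?addr0 // => j /negbTE ->; rewrite mul0r.
rewrite mxE /nsum mulr_sumr -!sumrB; apply: eq_bigr => j _.
rewrite !mxE (adj_sym H i j); case: eqVneq => [->|_] /=.
  by rewrite adj_irr /=; ring.
by case: (H j i) => /=; ring.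
Qed.

Lemma seidel_eigenP (R : realType) n (H : sgraph n) (x : 'rV[R]_n) a :
  x *m seidel R H = a *: x <->
  forall i, (a + 1) * x 0 i = \sum_j x 0 j - 2 * nsum H x i.
Proof.
split=> [e i|e].
  by have := congr1 (fun v : 'rV_n => v 0 i) e; rewrite seidel_mulE mxE; lra.
by apply/rowP => i; rewrite seidel_mulE mxE; have := e i; lra.
Qed.

Section Star.
Variables (R : realType) (k m : nat).
Implicit Type v : 'rV[R]_k.+1.
Let S := star k.+1 m.

Lemma sum_leaves (c : R) (N : nat) :
  \sum_(j < N) (if (0 < j <= m)%N then c else 0) = c *+ minn m N.-1.
Proof.
elim: N => [|N IH]; first by rewrite big_ord0 minn0.
rewrite big_ord_recr /= IH; case: ifPn => h.
  by rewrite -mulrSr; congr (_ *+ _); lia.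
by rewrite addr0; congr (_ *+ _); lia.
Qed.

Lemma nsum_star_center v :
  nsum S v ord0 = \sum_(j < k.+1) (if (0 < j <= m)%N then v 0 j else 0).
Proof.
apply: eq_bigr => j _; rewrite /= /star_rel /= andbF orbF.
by case: ifP => _; rewrite ?mul1r ?mul0r.
Qed.

Lemma nsum_star_leaf v (i : 'I_k.+1) : (0 < i)%N ->
  nsum S v i = if (i <= m)%N then v 0 ord0 else 0.
Proof.
move=> i0; rewrite /nsum (bigD1 ord0) //= big1 => [|j j0].
  by rewrite /star_rel /= i0 andbF /= addr0; case: ifP => _; rewrite ?mul1r ?mul0r.
have -> : star_rel m i j = false; last by rewrite mul0r.
have : (j != 0 :> nat)%N by [].
by rewrite /star_rel; lia.
Qed.

Hypothesis mk : (0 < m < k)%N.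
Hypothesis k3 : (2 < k)%N.
Let M : R := m%:R.
Let K : R := k%:R.

(** The difference [(M + 1) ^ 2 - 4 * M = (M - 1) ^ 2] is positive unless [M = 1], and then
    [mu >= 3] suffices. *)
Lemma star_ineqs (mu : R) : K <= mu ->
  [/\ 1 <= M, M + 1 <= K, 3 <= mu & 4 * M < mu ^+ 2].
Proof.
move=> Kmu; have M1 : 1 <= M by rewrite ler1n; lia.
have MK : M + 1 <= K by rewrite natr1 ler_nat; lia.
have K3 : 3 <= K by rewrite ler_nat.
split=> //; first exact: le_trans Kmu.
have : mu ^+ 2 - (M + 1) ^+ 2 >= 0.
  by rewrite subr_ge0 lerXn2r ?nnegrE //; lra.
have [M2|M2] : M = 1 \/ 2 <= M.
  rewrite /M; have [->|h] : m = 1%N \/ (1 < m)%N by lia.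
    by left.
  by right; rewrite ler_nat.
  by rewrite M2; nra.
by nra.
Qed.

(** The centre entry, the sum [L] over the leaves and the total [s] satisfy three linear equations;
    eliminating the first two leaves the cubic times [s]. *)
Lemma star_eigenvalue_cubic (a : R) : K <= a + 1 -> eigenvalue (seidel R S) a ->
  (a + 1) ^+ 2 * (1 + K - (a + 1)) = 4 * M * (K - M).
Proof.
set mu := a + 1 => Kmu /eigenvalueP[v /seidel_eigenP e v0].
have [M1 MK mu3 Mmu] := star_ineqs Kmu.
rewrite -/mu in e; set s := \sum_j v 0 j in e.
have mu0 : mu != 0 by rewrite gt_eqF //; lra.
pose L := nsum S v ord0; have e0 : mu * v 0 ord0 = s - 2 * L by exact: e.
have el (i : 'I_k.+1) : (0 < i)%N ->
    mu * v 0 i = s - 2 * (if (i <= m)%N then v 0 ord0 else 0).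
  by move=> i0; rewrite e nsum_star_leaf.
have eL : mu * L = M * (s - 2 * v 0 ord0).
  rewrite /L nsum_star_center mulr_sumr.
  transitivity (\sum_(j < k.+1) (if (0 < j <= m)%N then s - 2 * v 0 ord0 else 0)).
    apply: eq_bigr => j _; case: ifPn => [/andP[j0 jm]|_]; last by rewrite mulr0.
    by rewrite el // jm.
  by rewrite sum_leaves -[LHS]mulr_natl /M; congr (_%:R * _); lia.
have es : mu * s = (1 + K) * s - 2 * (L + M * v 0 ord0).
  rewrite mulr_sumr; under eq_bigr => j _ do rewrite e.
  rewrite sumrB sumr_const card_ord -mulr_sumr -[s *+ _]mulr_natl -natr1 [k%:R + 1]addrC.
  congr (_ * _ - 2 * _); rewrite big_ord_recl; congr (_ + _).
  transitivity (\sum_(i < k.+1) (if (0 < i <= m)%N then v 0 ord0 else 0)).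
    rewrite [RHS]big_ord_recl /= add0r; apply: eq_bigr => i _.
    by rewrite nsum_star_leaf.
  by rewrite sum_leaves -[LHS]mulr_natl /M; congr (_%:R * _); lia.
(* With total zero, [mu ^ 2 <> 4 * M] forces the centre entry to vanish, and then all entries
   vanish. *)
have s0 : s != 0.
  apply: contra_neq v0 => s0.
  have c0 : v 0 ord0 = 0.
    have : (mu ^+ 2 - 4 * M) * v 0 ord0 = 0.
      have -> : (mu ^+ 2 - 4 * M) * v 0 ord0 = mu * (mu * v 0 ord0) - 4 * M * v 0 ord0 by ring.
      by rewrite e0 s0 mulrBr [mu * (2 * L)]mulrCA eL s0; ring.
    by move/eqP; rewrite mulf_eq0 => /orP[] /eqP //; lra.
  apply/rowP => i; rewrite mxE; have [i0|i0] := posnP i.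
    by rewrite -c0; congr (v 0 _); exact: val_inj.
  by apply: (mulfI mu0); rewrite el // s0 c0; case: ifP => _; ring.
apply: (mulfI s0); apply: (mulfI mu0).
have kE : (mu ^+ 2 - 4 * M) * v 0 ord0 = (mu - 2 * M) * s.
  have -> : (mu ^+ 2 - 4 * M) * v 0 ord0 = mu * (mu * v 0 ord0) - 4 * M * v 0 ord0 by ring.
  by rewrite e0 mulrBr [mu * (2 * L)]mulrCA eL; ring.
have sE : (mu * (mu - (1 + K)) + 2 * M) * s = 2 * M * (2 - mu) * v 0 ord0.
  have : mu * (mu * s) = mu * ((1 + K) * s - 2 * (L + M * v 0 ord0)) by rewrite es.
  have -> : mu * ((1 + K) * s - 2 * (L + M * v 0 ord0)) =
    mu * (1 + K) * s - 2 * (mu * L) - 2 * M * mu * v 0 ord0 by ring.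
  by rewrite eL; lra.
have : (mu * (mu - (1 + K)) + 2 * M) * s * (mu ^+ 2 - 4 * M) =
    2 * M * (2 - mu) * ((mu ^+ 2 - 4 * M) * v 0 ord0) by rewrite sE; ring.
by rewrite kE; lra.
Qed.

Lemma star_eigenvalue_root (r : R) : K <= r ->
    r ^+ 2 * (1 + K - r) = 4 * M * (K - M) -> eigenvalue (seidel R S) (r - 1).
Proof.
move=> Kr cub; have [M1 MK r3 Mr] := star_ineqs Kr.
(* The eigenvector is [r * (r - 2 m)] at the centre, [r * (r - 2)] on the leaves
   and [r ^ 2 - 4 m] on the isolated vertices. *)
pose u (j : nat) :=
  (r ^+ 2 - 4 * M) + (if (0 < j <= m)%N then 4 * M - 2 * r else 0)
  + (j == 0)%:R * (4 * M - 2 * M * r).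
pose v : 'rV[R]_k.+1 := \row_j u j.
have vE j : v 0 j = u j by rewrite mxE.
(* By the cubic equation the total is [r] times the entry at an isolated vertex, as the eigenvalue
   equation there demands. *)
have sE : \sum_j v 0 j = r ^+ 3 - 4 * M * r.
  under eq_bigr => j _ do rewrite vE.
  rewrite 2!big_split /= sum_leaves sumr_const card_ord [X in _ + X]big_ord_recl /=.
  rewrite big1 => [|i _]; last by rewrite /bump /= mul0r.
  rewrite (_ : minn m k = m); last by lia.
  rewrite -[(r ^+ 2 - 4 * M) *+ _]mulr_natl -[(4 * M - 2 * r) *+ _]mulr_natl.
  rewrite -natr1 -/K -/M.
  rewrite mul1r addr0; move: cub; lra.
apply/eigenvalueP; exists v.
  apply/seidel_eigenP => i; rewrite sE subrK vE; have [i0|i0] := posnP i.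
    have -> : i = ord0 by exact: val_inj.
    rewrite nsum_star_center.
    transitivity (r ^+ 3 - 4 * M * r -
        2 * \sum_(j < k.+1) (if (0 < j <= m)%N then r * (r - 2) else 0)).
      rewrite sum_leaves -[X in _ - 2 * X]mulr_natl (_ : minn m k.+1.-1 = m); last by lia.
      by rewrite -/M /u /=; ring.
    congr (_ - 2 * _); apply: eq_bigr => j _; case: ifP => // h.
    have j0 : (j == 0%N :> nat) = false by lia.
    by rewrite vE /u h j0 /=; ring.
  rewrite nsum_star_leaf // vE /u i0 /=; have -> : (i == 0%N :> nat) = false by lia.
  by case: ifP => _; rewrite /=; ring.
(* The last vertex is isolated because [m < k], and its entry [r ^ 2 - 4 * M] is positive. *)
apply/eqP => /rowP/(_ ord_max); rewrite vE mxE /u /=.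
have -> : (k <= m)%N = false by lia.
have -> : (k == 0)%N = false by lia.
by rewrite andbF /= mul0r !addr0; lra.
Qed.

(** Intermediate values on [[K, 1 + K]]: the difference of the two sides is [(K - 2 * M) ^ 2] at the
    left end and [- 4 * M * (K - M)] at the right end. *)
Lemma star_cubic_root :
  exists2 r : R, K <= r & r ^+ 2 * (1 + K - r) = 4 * M * (K - M).
Proof.
have [M1 MK _ _] := star_ineqs (lexx K).
pose p : {poly R} := 'X^2 * ((1 + K)%:P - 'X) - (4 * M * (K - M))%:P.
have pE t : p.[t] = t ^+ 2 * (1 + K - t) - 4 * M * (K - M) by rewrite /p !hornerE.
have [||r rK /rootP] := @polyrcf.poly_ivt R p K (1 + K).
- by rewrite lerDr.
- rewrite !pE mulr_ge0_le0 //.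
    have : 0 <= (K - 2 * M) ^+ 2 by exact: sqr_ge0.
    lra.
  have : 0 <= M * (K - M) by rewrite mulr_ge0 //; lra.
  lra.
rewrite pE => /eqP; rewrite subr_eq0 => /eqP; exists r => //.
by move: rK; rewrite in_itv => /andP[].
Qed.

End Star.

(** A root of the cubic that is at least [k] yields an eigenvalue, so the largest eigenvalue
    satisfies [k <= mu] and hence the cubic. *)
Lemma rho_star_cubic (R : realType) (k m : nat) (mu := rho R (star k.+1 m) + 1) :
  (0 < m < k)%N -> k%:R <= mu /\
    mu ^+ 2 * (1 + k%:R - mu) = 4 * m%:R * (k%:R - m%:R).
Proof.
(* For [k = 2] one has [mu ^ 2 = 4 * m] and the elimination degenerates, so the explicit value of
   [rho] is used. *)
move=> mk; have [k3|k2] := ltnP 2 k; last first.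
  rewrite {}/mu; have [-> ->] : m = 1%N /\ k = 2%N by lia.
  by rewrite rho_star31; split; lra.
have [e max] := @rhoP R k.+1 (star k.+1 m) isT.
have [r Kr cub] := star_cubic_root R mk k3.
have kmu : k%:R <= mu.
  by have := max _ (star_eigenvalue_root mk k3 Kr cub); rewrite /mu; lra.
by split=> //; exact: star_eigenvalue_cubic.
Qed.

(** * The Seidel form *)

Section Rayleigh.
Variables (R : realType) (n : nat).
Implicit Types (H : sgraph n) (x : 'rV[R]_n).

Lemma seidel_form H x : (x *m seidel R H *m x^T) 0 0 =
  (\sum_i x 0 i) ^+ 2 - \sum_i x 0 i ^+ 2 - 2 * \sum_i x 0 i * nsum H x i.
Proof.
rewrite mxE expr2 !mulr_suml mulr_sumr -!sumrB; apply: eq_bigr => i _.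
by rewrite seidel_mulE mxE; ring.
Qed.

Lemma nsumZ H x a i : nsum H (a *: x) i = a * nsum H x i.
Proof. by rewrite /nsum mulr_sumr; apply: eq_bigr => j _; rewrite mxE; ring. Qed.

(** The factor [c] makes the entries sum to [mu]; the gap in the energy bound is then a positive
    multiple of the gap in the theorem when [mu] is nonzero. *)
Lemma energy_seidel H x mu : unit_vector x -> \sum_i x 0 i != 0 ->
  let c := mu / \sum_i x 0 i in
  energy H mu (c *: x) - mu * (n%:R - mu) =
  c ^+ 2 * (mu - 1 - (x *m seidel R H *m x^T) 0 0).
Proof.
move=> xu; set s := \sum_i _ => s0 c.
have cs : c * s = mu by rewrite divfK.
rewrite seidel_form xu -/s /energy.
have -> : \sum_i (1 - (c *: x) 0 i) ^+ 2 = n%:R - 2 * (c * s) + c ^+ 2.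
  transitivity (\sum_i (1 - 2 * (c * x 0 i) + c ^+ 2 * x 0 i ^+ 2)).
    by apply: eq_bigr => i _; rewrite mxE; ring.
  by rewrite big_split sumrB /= sumr_const card_ord -!mulr_sumr xu mulr1.
have -> : \sum_i (c *: x) 0 i * nsum H (c *: x) i =
    c ^+ 2 * \sum_i x 0 i * nsum H x i.
  by rewrite mulr_sumr; apply: eq_bigr => i _; rewrite nsumZ mxE; ring.
have : c ^+ 2 * s ^+ 2 = mu ^+ 2 by rewrite -exprMn cs.
by rewrite cs; lra.
Qed.

(** Each missing edge removes a positive product [z_i * z_j]. *)
Lemma energy_subgraph (K H : sgraph n) mu (z : 'rV[R]_n) :
    (forall i j, K i j -> H i j) -> (gsize K < gsize H)%N ->
    (forall i, 0 < z 0 i) ->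
  energy K mu z < energy H mu z.
Proof.
move=> KH cKH z0; rewrite /energy ltrD2l ltr_pM2l // -subr_gt0 -sumrB.
have zD i : 0 <= z 0 i * nsum H z i - z 0 i * nsum K z i.
  rewrite -mulrBr mulr_ge0 ?(ltW (z0 i)) // -sumrB sumr_ge0 // => j _.
  rewrite -mulrBl mulr_ge0 ?(ltW (z0 j)) //.
  by case: (boolP (K i j)) => [/KH ->|]; rewrite ?subrr ?subr0.
rewrite lt_neqAle sumr_ge0 ?andbT // eq_sym; apply/negP.
rewrite psumr_eq0 // => /allP h.
have [i [j [Hij Kij]]] : exists i j, H i j /\ ~~ K i j.
  have /subsetPn[e /edgesP[i [j [Hij ->]]]] : ~~ (edges H \subset edges K).
    by apply/negP => /subset_leq_card; rewrite leqNgt cKH.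
  by rewrite mem_edges; exists i, j.
have := h i (mem_index_enum _); rewrite /= -mulrBr mulf_eq0 gt_eqF //=.
rewrite -sumrB psumr_eq0 => [/allP/(_ j (mem_index_enum _))|l _].
  by rewrite /= Hij (negbTE Kij) mul0r subr0 mul1r gt_eqF.
rewrite -mulrBl mulr_ge0 ?(ltW (z0 l)) //.
by case: (boolP (K i l)) => [/KH ->|]; rewrite ?subrr ?subr0.
Qed.
End Rayleigh.

(** The equality criterion is restricted to [3 < n] because it fails for order 3: [equality_order3]
    attains equality with [m = (n - 1) / 2]. *)
Theorem theorem3p3 (R : realType) (n m : nat) (H : sgraph n) (x : 'rV[R]_n)
    (m_bounds : (0 < m < n - 1)%N) (H_size : gsize H = m)
    (x_unit : unit_vector x) (x_pos : forall i, 0 < x 0 i) :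
  (x *m seidel R H *m x^T) 0 0 <= rho R (star n m) /\
  ((3 < n)%N ->
   ((x *m seidel R H *m x^T) 0 0 = rho R (star n m) <->
    [/\ (m%:R < (n%:R - 1) / 2 :> R),
        isomorphic H (star n m)
      & eigenvector (seidel R H) (rho R (star n m)) x])).
Proof.
case: n H x m_bounds H_size x_unit x_pos => [|k] H x m_bounds; first by lia.
move=> H_size xu x0.
have mk : (0 < m < k)%N by lia.
have [kmu cub] := rho_star_cubic R mk.
set Q := (_ *m _) 0 0; set r := rho R (star k.+1 m) in kmu cub *.
set mu := r + 1 in kmu cub; set s := \sum_i x 0 i.
have M1 : 1 <= m%:R :> R by rewrite ler1n; lia.
have MK : m%:R + 1 <= k%:R :> R by rewrite natr1 ler_nat; lia.
have s0 : 0 < s.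
  rewrite /s big_ord_recl ltr_pwDl // sumr_ge0 // => i _; exact/ltW.
pose c := mu / s; have c0 : 0 < c by rewrite divr_gt0 //; lra.
pose z := c *: x; have z0 i : 0 < z 0 i by rewrite mxE mulr_gt0.
have z0' i : 0 <= z 0 i by exact/ltW.
have EQ : energy H mu z - mu * (1 + k%:R - mu) = c ^+ 2 * (r - Q).
  have := @energy_seidel _ _ H x mu xu (lt0r_neq0 s0).
  by rewrite /= -/s -/c -/z -/Q -natr1 [k%:R + 1]addrC /mu addrK.
have c2 : 0 < c ^+ 2 by rewrite exprn_gt0.
have boundP : (mu * (1 + k%:R - mu) <= energy H mu z) = (Q <= r).
  by rewrite -subr_ge0 EQ pmulr_rge0 // subr_ge0.
have [ms|sm] := leqP m (k - m).
  have mE : (gsize H)%:R = m%:R :> R by rewrite H_size.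
  pose S := k%:R - m%:R : R.
  have S1 : (gsize H)%:R + S = k%:R by rewrite mE /S addrC subrK.
  have mS : (gsize H)%:R <= S by rewrite mE /S -natrB ?ler_nat //; lia.
  have gM1 : 1 <= (gsize H)%:R :> R by rewrite mE.
  have gmu : (gsize H)%:R + S <= mu by rewrite S1.
  have gcub : mu ^+ 2 * (1 + (gsize H)%:R + S - mu) = 4 * (gsize H)%:R * S.
    by rewrite -[1 + _ + _]addrA S1 mE.
  have bnd : Q <= r.
    rewrite -boundP; have := energy_bound gM1 mS gmu gcub z0'.
    by rewrite -[1 + _ + _]addrA S1.
  split=> // n3; split=> [Qr|[_ _ [_ eig]]]; last first.
    rewrite /Q eig -scalemxAl !mxE -[RHS]mulr1 -xu; congr (_ * _).
    by apply: eq_bigr => i _; rewrite mxE expr2.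
  have S3 : 3 <= (gsize H)%:R + S by rewrite S1 ler_nat; lia.
  have E : energy H mu z = mu * (1 + (gsize H)%:R + S - mu).
    rewrite -[1 + (gsize H)%:R + S]addrA S1; move: EQ.
    by rewrite Qr subrr mulr0; lra.
  have [[i di] mS' st] := energy_eq gM1 mS gmu gcub S3 z0 E.
  split.
  - by move: mS'; rewrite mE /S -natr1; lra.
  - by rewrite -H_size; exact: star_iso di.
  split; first by apply/eqP => x00; have := x0 ord0; rewrite x00 mxE ltxx.
  apply/seidel_eigenP => j; rewrite -/mu -/s.
  have := st j; rewrite nsumZ mxE => stj.
  (* Since [c * s = mu], the stationarity equation of [z] is [c] times the eigenvalue equation of
     [x]. *)
  apply: (mulfI (lt0r_neq0 c0)).
  have cs : c * s = mu by rewrite divfK // gt_eqF.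
  by rewrite mulrBr cs; lra.
(* For [m > k - m] the bound is applied to a subgraph with [k - m] edges, the cubic being symmetric
   in [m] and [k - m]; the deleted edges make it strict for [H]. *)
have [K Ks KH] := @subgraph _ H (k - m) ltac:(rewrite H_size; exact: ltnW).
have KsR : (gsize K)%:R = k%:R - m%:R :> R by rewrite Ks natrB //; lia.
have lt : mu * (1 + k%:R - mu) < energy H mu z.
  apply: le_lt_trans (energy_subgraph mu KH _ z0); last by rewrite Ks H_size.
  have := @energy_bound R k.+1 K mu m%:R; rewrite KsR -[1 + _ + _]addrA subrK.
  apply=> //.
  - lra.
  - by rewrite -natrB ?ler_nat; lia.
  - by rewrite cub; ring.
have Qr : Q < r by move: lt; rewrite -subr_gt0 EQ pmulr_rgt0 // subr_gt0.
split; first exact: ltW.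
move=> _; split=> [e|[mn _ _]]; first by move: Qr; rewrite e ltxx.
(* Here [m < (n - 1) / 2] fails too, so both sides of the equivalence are false. *)
have : k%:R <= 2 * m%:R :> R by rewrite -natrM ler_nat; lia.
by move: mn; rewrite -natr1; lra.
Qed.
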